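(* For $t\ge 0$ let $$u_t(x,y)=\ln\left(\frac{2e^x}{1+t^2+2te^x\cos y+e^{2x}}\right),\qquad (x,y)\in\mathbb{R}^2 .$$ Then for each $t\ge 0$, $u_t$ solves $\Delta u_t+e^{2u_t}=0$ in $\mathbb{R}^2$. Moreover, $\mathrm{diam}_g(\mathbb{R}^2)=\pi+2\tan^{-1}(t)$, where $g=e^{2u_t}\delta$.
   Context: $\delta$ is the Euclidean metric on $\mathbb{R}^2$. For a Riemannian metric $g$ on $\mathbb{R}^2$, $d_g(p,q)$ is the infimum of the $g$-lengths of piecewise smooth curves from $p$ to $q$ (for $g=e^{2u}\delta$ the length of $\gamma:[a,b]\to\mathbb{R}^2$ is $\int_a^b e^{u(\gamma(s))}|\gamma'(s)|\,ds$), and $\mathrm{diam}_g(\mathbb{R}^2)=\sup_{p,q\in\mathbb{R}^2} d_g(p,q)$. *)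

(* Defs.v *)
From Stdlib Require Import Reals.
From Coquelicot Require Import Coquelicot.
Open Scope R_scope.

(** * Metrics on the plane *)

(* [g p v w] is the inner product of the tangent vectors [v], [w] at [p].
   The definitions below use only these values, so bilinearity, symmetry,
   positivity and smoothness of [g] are not bundled. *)
Definition metric : Type := R * R -> R * R -> R * R -> R.

Definition euclidean : metric :=
  fun _ v w => fst v * fst w + snd v * snd w.

(* The metric e^{2u} delta. *)
Definition conformal (u : R -> R -> R) : metric :=
  fun p v w => exp (2 * u (fst p) (snd p)) * euclidean p v w.

Definition metric_norm (g : metric) (p v : R * R) : R := sqrt (g p v v).

Lemma metric_norm_conformal (u : R -> R -> R) (p v : R * R) :
  metric_norm (conformal u) p v =
  exp (u (fst p) (snd p)) * metric_norm euclidean p v.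
Proof.
unfold metric_norm, conformal.
replace (2 * u (fst p) (snd p)) with (u (fst p) (snd p) + u (fst p) (snd p))
  by ring.
rewrite exp_plus, sqrt_mult_alt, sqrt_square; auto using Rlt_le, exp_pos.
apply Rlt_le, Rmult_lt_0_compat; apply exp_pos.
Qed.

(** * Piecewise smooth curves *)

Definition smooth (f : R -> R) : Prop := forall n s, ex_derive_n f n s.

(* Smoothness on a closed interval: restriction of a smooth map on the line. *)
Definition smooth_on (c : R -> R * R) (a b : R) : Prop :=
  exists x y : R -> R, smooth x /\ smooth y /\
    forall s, a <= s <= b -> c s = (x s, y s).

(* Adjacent pieces both contain their common endpoint, so such a curve is
   automatically continuous on [a, b]. *)
Inductive piecewise_smooth (c : R -> R * R) : R -> R -> Prop :=
| piecewise_smooth_piece a b :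
    a < b -> smooth_on c a b -> piecewise_smooth c a b
| piecewise_smooth_cat a m b :
    piecewise_smooth c a m -> piecewise_smooth c m b -> piecewise_smooth c a b.

Definition velocity (c : R -> R * R) (s : R) : R * R :=
  (Derive (fun r => fst (c r)) s, Derive (fun r => snd (c r)) s).

(* The value of [velocity] at the finitely many break points and at the
   endpoints is irrelevant to the integral. *)
Definition length (g : metric) (c : R -> R * R) (a b : R) : R :=
  RInt (fun s => metric_norm g (c s) (velocity c s)) a b.

(** * Distance and diameter *)

Definition dist (g : metric) (p q : R * R) : Rbar :=
  Glb_Rbar (fun l => exists (c : R -> R * R) (a b : R),
    piecewise_smooth c a b /\ c a = p /\ c b = q /\ l = length g c a b).

Definition diam (g : metric) : Rbar :=
  Rbar_lub (fun d => exists p q : R * R, d = dist g p q).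

(** * The equation *)

Definition laplacian (u : R -> R -> R) (x y : R) : R :=
  partial_derive 2 0 u x y + partial_derive 0 2 u x y.

(* Classical solutions: [u] is required to be of class C^2, since
   [partial_derive] is a total function. *)
Definition solves_liouville (u : R -> R -> R) : Prop :=
  forall x y, ex_diff_n u 2 x y /\ laplacian u x y + exp (2 * u x y) = 0.

Definition u_sol (t x y : R) : R :=
  ln (2 * exp x / (1 + t ^ 2 + 2 * t * exp x * cos y + exp (2 * x))).

(* Main.v *)
Require Import Defs.
From Stdlib Require Import Reals Lra Psatz ssreflect.
From Coquelicot Require Import Coquelicot.
Open Scope R_scope.

(** Write z = x + iy. The conformal factor is exp (u_t) = 2 |e^z| / (1 + |e^z + t|^2),
so e^{2 u_t} delta is the pullback of the round metric 4 |dw|^2 / (1 + |w|^2)^2 of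
curvature 1 by the map w = e^z + t. That map is the universal covering of the
sphere minus the two points t and infinity, which are at spherical distance
pi - 2 atan t. The Liouville equation says that the curvature is 1; here it is
checked on the explicit second derivatives.

Upper bound. A ray of the w-plane issued from the origin is a great circle arc
ending at infinity, so a point p can be moved arbitrarily far to the right in
the (x, y)-plane at a cost at most d(p) = pi - 2 atan |w(p)|, the spherical
distance from w(p) to infinity ([escape_to_infinity]). Far to the right,
vertical segments are arbitrarily short, so p and q are joined by a curve of
length d(p) + d(q) + eps ([chain_through_infinity]). The rotation of the sphere
by a half turn that swaps t and infinity lifts to the isometry
(x, y) |-> (ln (1 + t^2) - x, - y) of the plane ([chain_half_turn]); through it
p and q are also joined with length d'(p) + d'(q) + eps, where d' is the
spherical distance to t. The perimeter of a spherical triangle is at most 2 pi,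
hence d + d' <= pi + 2 atan t ([cost_half_turn]), and one of the two detours has
length at most pi + 2 atan t + eps.

Lower bound. The great circle through t and infinity is the real w-axis; its long
arc, of length pi + 2 atan t, is the image of the line y = pi and its short arc the
image of y = 0. Let m be the midpoint of the long arc. The two lifts of m
with y = pi and y = - pi are separated by the line y = 0, and since the
antipode of m is the midpoint of the short arc, every point of the short arc is at
distance at least half of pi + 2 atan t from m. A curve between the two lifts
pays this distance twice ([length_ge_pi_atan]). *)

(** * The Liouville equation *)

(** Turns the pointwise statement about iterated [Derive] into one about
explicit candidates for the partial derivatives. *)
Lemma ex_diff_n_2_of_partials (f fx fy fxx fxy fyx fyy : R -> R -> R) (x y : R) :
  (forall x y, is_derive (fun z => f z y) x (fx x y)) ->
  (forall x y, is_derive (fun z => f x z) y (fy x y)) ->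
  (forall x y, is_derive (fun z => fx z y) x (fxx x y)) ->
  (forall x y, is_derive (fun z => fx x z) y (fxy x y)) ->
  (forall x y, is_derive (fun z => fy z y) x (fyx x y)) ->
  (forall x y, is_derive (fun z => fy x z) y (fyy x y)) ->
  continuity_2d_pt f x y -> continuity_2d_pt fx x y ->
  continuity_2d_pt fy x y -> continuity_2d_pt fxx x y ->
  continuity_2d_pt fxy x y -> continuity_2d_pt fyx x y ->
  continuity_2d_pt fyy x y ->
  ex_diff_n f 2 x y /\ laplacian f x y = fxx x y + fyy x y.
Proof.
intros Hx Hy Hxx Hxy Hyx Hyy C Cx Cy Cxx Cxy Cyx Cyy.
assert (first_order : forall g gx gy : R -> R -> R,
  (forall x y, is_derive (fun z => g z y) x (gx x y)) ->
  (forall x y, is_derive (fun z => g x z) y (gy x y)) ->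
  continuity_2d_pt g x y -> continuity_2d_pt gx x y ->
  continuity_2d_pt gy x y -> ex_diff_n g 1 x y).
{ intros g gx gy Gx Gy D Dx Dy.
  repeat split; [exact D | eexists; apply Gx | eexists; apply Gy | |].
  - apply continuity_2d_pt_ext with (2 := Dx); intros.
    symmetry; apply is_derive_unique, Gx.
  - apply continuity_2d_pt_ext with (2 := Dy); intros.
    symmetry; apply is_derive_unique, Gy. }
split.
- split; [exact C | split; [eexists; apply Hx | split; [eexists; apply Hy |]]].
  split.
  + apply ex_diff_n_ext_loc with fx; [| now apply first_order with fxx fxy].
    apply locally_2d_forall; intros.
    symmetry; apply is_derive_unique, Hx.
  + apply ex_diff_n_ext_loc with fy; [| now apply first_order with fyx fyy].
    apply locally_2d_forall; intros.
    symmetry; apply is_derive_unique, Hy.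
- unfold laplacian, partial_derive; simpl; f_equal.
  + rewrite (Derive_ext _ (fun z => fx z y)); [now apply is_derive_unique |].
    intros; now apply is_derive_unique.
  + rewrite (Derive_ext _ (fun z => fy x z)); [now apply is_derive_unique |].
    intros; now apply is_derive_unique.
Qed.

(** This is 1 + |w|^2 with w = e^z + t. *)
Definition denom (t x y : R) : R :=
  1 + t ^ 2 + 2 * t * exp x * cos y + exp (2 * x).

Lemma exp_double (x : R) : exp (2 * x) = exp x ^ 2.
Proof. replace (2 * x) with (x + x) by ring; rewrite exp_plus; ring. Qed.

Lemma denom_sum_squares (t x y : R) :
  denom t x y = 1 + ((t + exp x * cos y) ^ 2 + (exp x * sin y) ^ 2).
Proof.
unfold denom; rewrite exp_double.
assert (H := sin2_cos2 y); unfold Rsqr in H.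
replace ((exp x * sin y) ^ 2) with (exp x ^ 2 * (1 - cos y * cos y));
  [ring | rewrite <- H; ring].
Qed.

Lemma denom_pos (t x y : R) : 0 < denom t x y.
Proof.
rewrite denom_sum_squares.
generalize (pow2_ge_0 (t + exp x * cos y)), (pow2_ge_0 (exp x * sin y)); lra.
Qed.

(** The conformal factor exp (u_t), that is 2 |dw/dz| / (1 + |w|^2). *)
Definition density (t x y : R) : R := 2 * exp x / denom t x y.

Lemma density_pos (t x y : R) : 0 < density t x y.
Proof.
apply Rdiv_lt_0_compat; [generalize (exp_pos x); lra | apply denom_pos].
Qed.

Lemma exp_u_sol (t x y : R) : exp (u_sol t x y) = density t x y.
Proof. unfold u_sol; apply exp_ln, density_pos. Qed.

Lemma u_sol_expand (t x y : R) : u_sol t x y = ln 2 + x - ln (denom t x y).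
Proof.
unfold u_sol; fold (denom t x y).
rewrite -> ln_div, ln_mult, ln_exp; try lra; try apply exp_pos; try apply denom_pos.
generalize (exp_pos x); lra.
Qed.

Ltac continuity_2d :=
  repeat match goal with
  | |- continuity_2d_pt (fun _ _ => ?c) _ _ => apply continuity_2d_pt_const
  | |- continuity_2d_pt (fun u v => u) _ _ => apply continuity_2d_pt_id1
  | |- continuity_2d_pt (fun u v => v) _ _ => apply continuity_2d_pt_id2
  | |- continuity_2d_pt (fun u v => @?f u v + @?g u v) _ _ =>
      apply continuity_2d_pt_plus
  | |- continuity_2d_pt (fun u v => @?f u v - @?g u v) _ _ =>
      apply continuity_2d_pt_minus
  | |- continuity_2d_pt (fun u v => - @?f u v) _ _ =>
      apply continuity_2d_pt_opp
  | |- continuity_2d_pt (fun u v => @?f u v * @?g u v) _ _ =>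
      apply continuity_2d_pt_mult
  | |- continuity_2d_pt (fun u v => @?f u v / @?g u v) _ _ =>
      unfold Rdiv; apply continuity_2d_pt_mult
  | |- continuity_2d_pt (fun u v => / @?f u v) _ _ =>
      apply continuity_2d_pt_inv; 
      [| solve [repeat apply Rmult_integral_contrapositive_currified;
                apply Rgt_not_eq, denom_pos]]
  | |- continuity_2d_pt (denom _) _ _ => unfold denom
  | |- continuity_2d_pt (fun u v => exp (@?f u v)) _ _ =>
      apply (continuity_1d_2d_pt_comp exp f);
      [apply derivable_continuous_pt, derivable_pt_exp |]
  | |- continuity_2d_pt (fun u v => cos (@?f u v)) _ _ =>
      apply (continuity_1d_2d_pt_comp cos f); [apply continuity_cos |]
  | |- continuity_2d_pt (fun u v => sin (@?f u v)) _ _ =>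
      apply (continuity_1d_2d_pt_comp sin f); [apply continuity_sin |]
  end.

Lemma u_sol_solves (t : R) : solves_liouville (u_sol t).
Proof.
intros x y.
rewrite -> exp_double, exp_u_sol.
destruct (ex_diff_n_2_of_partials (u_sol t)
  (fun x y => 1 - (2 * t * exp x * cos y + 2 * exp (2 * x)) / denom t x y)
  (fun x y => 2 * t * exp x * sin y / denom t x y)
  (fun x y => ((2 * t * exp x * cos y + 2 * exp (2 * x))
               * (2 * t * exp x * cos y + 2 * exp (2 * x))
               - (2 * t * exp x * cos y + 4 * exp (2 * x)) * denom t x y)
              / (denom t x y * denom t x y))
  (fun x y => (2 * t * exp x * sin y * denom t x y
               - (2 * t * exp x * sin y)
                 * (2 * t * exp x * cos y + 2 * exp (2 * x)))
              / (denom t x y * denom t x y))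
  (fun x y => (2 * t * exp x * sin y * denom t x y
               - (2 * t * exp x * sin y)
                 * (2 * t * exp x * cos y + 2 * exp (2 * x)))
              / (denom t x y * denom t x y))
  (fun x y => (2 * t * exp x * cos y * denom t x y
               + (2 * t * exp x * sin y) * (2 * t * exp x * sin y))
              / (denom t x y * denom t x y))
  x y) as [C2 Lap];
  try (unfold Rdiv; solve [continuity_2d]).
all: try (intros a b; assert (H := Rgt_not_eq _ _ (denom_pos t a b));
  unfold denom in H |- *; auto_derive; [now repeat split | field; exact H]).
- intros a b; apply (is_derive_ext (fun z => ln 2 + z - ln (denom t z b))).
  { intros z; now rewrite u_sol_expand. }
  assert (H := denom_pos t a b); unfold denom in H |- *; auto_derive;
    [now repeat split | field; lra].
- intros a b; apply (is_derive_ext (fun z => ln 2 + a - ln (denom t a z))).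
  { intros z; now rewrite u_sol_expand. }
  assert (H := denom_pos t a b); unfold denom in H |- *; auto_derive;
    [now repeat split | field; lra].
- apply (continuity_2d_pt_ext (fun u v => ln 2 + u - ln (denom t u v))).
  { intros a b; now rewrite u_sol_expand. }
  continuity_2d.
  apply (continuity_1d_2d_pt_comp ln (denom t)).
  + apply derivable_continuous_pt; exists (/ denom t x y).
    apply derivable_pt_lim_ln, denom_pos.
  + unfold denom; continuity_2d.
- split; [exact C2 | rewrite Lap; unfold density].
  assert (H := Rgt_not_eq _ _ (denom_pos t x y)).
  assert (SC := sin2_cos2 y); unfold Rsqr in SC.
  rewrite exp_double.
  replace (2 * t * exp x * sin y * (2 * t * exp x * sin y))
    with (4 * t ^ 2 * exp x ^ 2 * (1 - cos y * cos y))
    by (rewrite <- SC; ring).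
  unfold denom in *; rewrite -> exp_double in *.
  field; exact H.
Qed.

(** * Smooth functions of one variable *)

(** A recursive form of differentiability in which the derivatives are data,
so that closure under the algebraic operations is a plain induction;
[Derive_n] of a product or of a composition has no usable closed form. *)
Fixpoint differentiable_times (n : nat) (f : R -> R) : Prop :=
  match n with
  | O => True
  | S n => exists g : R -> R,
      (forall s, is_derive f s (g s)) /\ differentiable_times n g
  end.

Lemma differentiable_times_pred (n : nat) (f : R -> R) :
  differentiable_times (S n) f -> differentiable_times n f.
Proof.
revert f; induction n as [|n IH]; [easy |].
intros f [g [Hg Dg]]; exists g; split; [exact Hg | now apply IH].
Qed.

Lemma smooth_differentiable_times (f : R -> R) :
  smooth f <-> forall n, differentiable_times n f.
Proof.
split.
- intros Hf.
  assert (H : forall n k, differentiable_times n (Derive_n f k)).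
  { induction n as [|n IH]; [easy | intros k].
    exists (Derive_n f (S k)); split; [| apply IH].
    intros s; simpl; apply Derive_correct, (Hf (S k)). }
  intros n; exact (H n O).
- intros Hf [|n] s; [exact I |].
  specialize (Hf (S n)); revert f Hf s; simpl ex_derive_n.
  induction n as [|n IH]; intros f [g [Hg Dg]] s.
  + exists (g s); apply Hg.
  + apply (ex_derive_ext (Derive_n g n)); [| now apply IH].
    intros r; rewrite <- (Nat.add_1_r n); rewrite <- Derive_n_comp.
    apply Derive_n_ext; intros z; symmetry; apply is_derive_unique, Hg.
Qed.

(** Bootstrapping: a function whose derivative is as regular as the function
itself is smooth. The inverse, the logarithm and the arctangent of a smooth
function are of this kind, since their derivatives are rational in that
function, its derivative and, for the inverse, the inverse itself. *)
Lemma smooth_step (f g : R -> R) :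
  (forall s, is_derive f s (g s)) ->
  (forall n, differentiable_times n f -> differentiable_times n g) ->
  smooth f.
Proof.
intros Hg Step; apply smooth_differentiable_times.
induction n as [|n IH]; [exact I | exists g; auto].
Qed.

Lemma differentiable_times_plus (n : nat) (f g : R -> R) :
  differentiable_times n f -> differentiable_times n g ->
  differentiable_times n (fun s => f s + g s).
Proof.
revert f g; induction n as [|n IH]; [easy |].
intros f g [f' [Hf Df]] [g' [Hg Dg]].
exists (fun s => f' s + g' s); split; [| now apply IH].
intros s; apply: is_derive_plus; auto.
Qed.

Lemma differentiable_times_mult (n : nat) (f g : R -> R) :
  differentiable_times n f -> differentiable_times n g ->
  differentiable_times n (fun s => f s * g s).
Proof.
revert f g; induction n as [|n IH]; [easy |].
intros f g Df Dg; generalize Df Dg.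
intros [f' [Hf Df']] [g' [Hg Dg']].
exists (fun s => f' s * g s + f s * g' s); split.
- intros s; apply: is_derive_mult; auto; intros; apply Rmult_comm.
- apply differentiable_times_plus; apply IH; auto using differentiable_times_pred.
Qed.

Lemma differentiable_times_comp_affine (n : nat) (f : R -> R) (a b : R) :
  differentiable_times n f -> differentiable_times n (fun s => f (a * s + b)).
Proof.
revert f; induction n as [|n IH]; [easy |].
intros f [f' [Hf Df]]; exists (fun s => a * f' (a * s + b)); split.
- intros s; apply (is_derive_comp f (fun s => a * s + b)); [apply Hf |].
  auto_derive; [easy | ring].
- assert (C : forall n c, differentiable_times n (fun _ : R => c)).
  { induction n0 as [|m IHm]; [easy | intros c; exists (fun _ => 0); split].
    - intros s; apply: is_derive_const.
    - apply IHm. }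
  apply differentiable_times_mult; [apply C | now apply IH].
Qed.

Lemma smooth_const (c : R) : smooth (fun _ => c).
Proof.
apply smooth_differentiable_times; intros n; revert c.
induction n as [|n IH]; [easy | intros c; exists (fun _ => 0); split; [| apply IH]].
intros s; apply: is_derive_const.
Qed.

Lemma smooth_id : smooth (fun s => s).
Proof.
apply (smooth_step _ (fun _ => 1)); [intros s; apply: is_derive_id |].
intros n _; apply smooth_differentiable_times, smooth_const.
Qed.

Lemma smooth_plus (f g : R -> R) :
  smooth f -> smooth g -> smooth (fun s => f s + g s).
Proof.
rewrite !smooth_differentiable_times; intros Hf Hg n.
now apply differentiable_times_plus.
Qed.

Lemma smooth_mult (f g : R -> R) :
  smooth f -> smooth g -> smooth (fun s => f s * g s).
Proof.
rewrite !smooth_differentiable_times; intros Hf Hg n.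
now apply differentiable_times_mult.
Qed.

Lemma smooth_opp (f : R -> R) : smooth f -> smooth (fun s => - f s).
Proof.
intros Hf n s; apply (ex_derive_n_ext (fun s => -1 * f s)); [intros; ring |].
now apply smooth_mult; [apply smooth_const |].
Qed.

Lemma smooth_comp_affine (f : R -> R) (a b : R) :
  smooth f -> smooth (fun s => f (a * s + b)).
Proof.
rewrite !smooth_differentiable_times; intros Hf n.
now apply differentiable_times_comp_affine.
Qed.

Lemma smooth_exp : smooth exp.
Proof. apply (smooth_step _ exp); [apply is_derive_exp | easy]. Qed.

Lemma smooth_derivative (f : R -> R) :
  smooth f -> exists g, smooth g /\ forall s, is_derive f s (g s).
Proof.
intros Hf; exists (Derive f); split.
- intros n s; destruct n as [|n]; [exact I |].
  apply (ex_derive_ext (Derive_n f (S n))); [| apply (Hf (S (S n)))].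
  intros r; rewrite <- (Nat.add_1_r n); now rewrite <- (Derive_n_comp f n 1).
- intros s; apply Derive_correct, (Hf 1%nat).
Qed.

Lemma smooth_inv (f : R -> R) :
  smooth f -> (forall s, f s <> 0) -> smooth (fun s => / f s).
Proof.
intros Hf nz; destruct (smooth_derivative f Hf) as [f' [Sf' Hf']].
apply (smooth_step _ (fun s => - f' s * (/ f s * / f s))).
- intros s; replace (- f' s * (/ f s * / f s)) with (- f' s / f s ^ 2)
    by (field; apply nz).
  apply is_derive_inv; auto.
- intros n D; apply differentiable_times_mult;
    [| now apply differentiable_times_mult].
  now apply smooth_differentiable_times, smooth_opp.
Qed.

Lemma smooth_ln (f : R -> R) :
  smooth f -> (forall s, 0 < f s) -> smooth (fun s => ln (f s)).
Proof.
intros Hf pos; destruct (smooth_derivative f Hf) as [f' [Sf' Hf']].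
apply (smooth_step _ (fun s => f' s * / f s)).
- intros s; apply (is_derive_comp ln f); [apply is_derive_ln, pos | apply Hf'].
- intros n _; apply smooth_differentiable_times, smooth_mult; [exact Sf' |].
  apply smooth_inv; [exact Hf | intros s; apply Rgt_not_eq, pos].
Qed.

Lemma smooth_atan (f : R -> R) : smooth f -> smooth (fun s => atan (f s)).
Proof.
intros Hf; destruct (smooth_derivative f Hf) as [f' [Sf' Hf']].
apply (smooth_step _ (fun s => f' s * / (1 + f s * f s))).
- intros s; apply (is_derive_comp atan f); [| apply Hf'].
  replace (f s * f s) with (f s ^ 2) by ring.
  apply is_derive_Reals, derivable_pt_lim_atan.
- intros n _; apply smooth_differentiable_times, smooth_mult; [exact Sf' |].
  apply smooth_inv; [| intros s; generalize (Rle_0_sqr (f s)); unfold Rsqr; lra].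
  apply smooth_plus; [apply smooth_const | now apply smooth_mult].
Qed.

(** * Lengths of piecewise smooth curves *)

Definition speed (t : R) (X Y : R -> R) (s : R) : R :=
  density t (X s) (Y s) * sqrt (Derive X s ^ 2 + Derive Y s ^ 2).

Definition integrand (t : R) (c : R -> R * R) (s : R) : R :=
  metric_norm (conformal (u_sol t)) (c s) (velocity c s).

(** Inside a piece the curve coincides with its smooth extension near every
point, hence has the same velocity; at the ends of the piece the velocity may
be anything. *)
Lemma integrand_piece (t : R) (c : R -> R * R) (X Y : R -> R) (a b s : R) :
  (forall s, a <= s <= b -> c s = (X s, Y s)) -> a < s < b ->
  integrand t c s = speed t X Y s.
Proof.
intros E Hs; unfold integrand, speed.
rewrite metric_norm_conformal exp_u_sol E; [| lra]; simpl fst; simpl snd.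
f_equal; unfold metric_norm, euclidean, velocity; simpl fst; simpl snd.
assert (Loc : locally s (fun r => a <= r <= b)).
{ apply (filter_imp (fun r => a < r /\ r < b)); [intros r; lra |].
  apply filter_and; [now apply open_gt | now apply open_lt]. }
rewrite (Derive_ext_loc (fun r => fst (c r)) X); [|].
2: { apply filter_imp with (2 := Loc); intros r Hr; now rewrite (E r Hr). }
rewrite (Derive_ext_loc (fun r => snd (c r)) Y); [|].
2: { apply filter_imp with (2 := Loc); intros r Hr; now rewrite (E r Hr). }
f_equal; ring.
Qed.

Lemma smooth_ex_derive (f : R -> R) (s : R) : smooth f -> ex_derive f s.
Proof. intros Hf; exact (Hf 1%nat s). Qed.

Lemma continuous_speed (t : R) (X Y : R -> R) (s : R) :
  smooth X -> smooth Y -> continuous (speed t X Y) s.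
Proof.
intros SX SY; apply: continuous_mult.
- apply: ex_derive_continuous.
  assert (P := denom_pos t (X s) (Y s)).
  assert (DX := smooth_ex_derive X s SX).
  assert (DY := smooth_ex_derive Y s SY).
  unfold density, denom in *; auto_derive; repeat split; auto; lra.
- apply (continuous_comp _ sqrt); [| apply continuous_sqrt].
  apply: ex_derive_continuous; auto_derive.
  split; [apply (SX 2%nat) | split; [apply (SY 2%nat) | exact I]].
Qed.

Lemma ex_RInt_speed (t : R) (X Y : R -> R) (a b : R) :
  smooth X -> smooth Y -> ex_RInt (speed t X Y) a b.
Proof.
intros SX SY; apply: ex_RInt_continuous.
intros s _; now apply continuous_speed.
Qed.

Lemma piecewise_smooth_lt (c : R -> R * R) (a b : R) :
  piecewise_smooth c a b -> a < b.
Proof. induction 1; lra. Qed.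

Lemma piecewise_smooth_ext (c d : R -> R * R) (a b : R) :
  piecewise_smooth c a b -> (forall s, a <= s <= b -> c s = d s) ->
  piecewise_smooth d a b.
Proof.
induction 1 as [a b ab [X [Y [SX [SY E]]]] | a m b H1 IH1 H2 IH2]; intros cd.
- apply piecewise_smooth_piece; [exact ab | exists X, Y].
  repeat split; auto; intros s Hs; now rewrite -cd; auto.
- assert (L1 := piecewise_smooth_lt _ _ _ H1).
  assert (L2 := piecewise_smooth_lt _ _ _ H2).
  apply piecewise_smooth_cat with m.
  + apply IH1; intros s Hs; apply cd; lra.
  + apply IH2; intros s Hs; apply cd; lra.
Qed.

Lemma piecewise_smooth_ex_RInt (t : R) (c : R -> R * R) (a b : R) :
  piecewise_smooth c a b -> ex_RInt (integrand t c) a b.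
Proof.
induction 1 as [a b ab [X [Y [SX [SY E]]]] | a m b H1 IH1 H2 IH2].
- apply (ex_RInt_ext (speed t X Y)); [| now apply ex_RInt_speed].
  rewrite -> Rmin_left, Rmax_right by lra.
  intros s Hs; symmetry; now apply integrand_piece with a b.
- now apply ex_RInt_Chasles with m.
Qed.

Lemma length_cat (t : R) (c : R -> R * R) (a m b : R) :
  piecewise_smooth c a m -> piecewise_smooth c m b ->
  length (conformal (u_sol t)) c a b =
  length (conformal (u_sol t)) c a m + length (conformal (u_sol t)) c m b.
Proof.
intros H1 H2; symmetry.
apply: (RInt_Chasles (integrand t c)); now apply piecewise_smooth_ex_RInt.
Qed.

Lemma piecewise_smooth_cut (c : R -> R * R) (a m b : R) :
  piecewise_smooth c a b -> a < m < b ->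
  piecewise_smooth c a m /\ piecewise_smooth c m b.
Proof.
intros H; revert m.
induction H as [a b ab [X [Y [SX [SY E]]]] | a n b H1 IH1 H2 IH2]; intros m Hm.
- split; (apply piecewise_smooth_piece; [easy | exists X, Y]);
    repeat split; auto; intros s Hs; apply E; lra.
- destruct (Rtotal_order m n) as [mn | [-> | nm]]; [| easy |].
  + destruct (IH1 m) as [A B]; [easy | split; [exact A |]].
    now apply piecewise_smooth_cat with n.
  + destruct (IH2 m) as [A B]; [easy | split; [| exact B]].
    now apply piecewise_smooth_cat with n.
Qed.

Lemma length_piece (t : R) (c : R -> R * R) (X Y : R -> R) (a b : R) :
  a < b -> (forall s, a <= s <= b -> c s = (X s, Y s)) ->
  length (conformal (u_sol t)) c a b = RInt (speed t X Y) a b.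
Proof.
intros ab E; apply: (RInt_ext (integrand t c)).
rewrite -> Rmin_left, Rmax_right by lra.
intros s Hs; now apply integrand_piece with a b.
Qed.

(** One smooth arc, given directly by smooth functions on the whole line and
starting at parameter 0: the form in which explicit arcs are produced. *)
Definition arc (t : R) (p q : R * R) (l : R) : Prop :=
  exists (X Y : R -> R) (S : R), smooth X /\ smooth Y /\ 0 < S /\
    (X 0, Y 0) = p /\ (X S, Y S) = q /\ RInt (speed t X Y) 0 S <= l.

Definition joined (t : R) (p q : R * R) (l : R) : Prop :=
  exists (c : R -> R * R) (a b : R), piecewise_smooth c a b /\
    c a = p /\ c b = q /\ length (conformal (u_sol t)) c a b <= l.

Lemma arc_joined (t : R) (p q : R * R) (l : R) : arc t p q l -> joined t p q l.
Proof.
intros [X [Y [S [SX [SY [S0 [P [Q L]]]]]]]].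
exists (fun s => (X s, Y s)), 0, S; repeat split; auto.
- apply piecewise_smooth_piece; [exact S0 | now exists X, Y].
- now rewrite (length_piece t _ X Y).
Qed.

(** One lemma for translation of the parameter (to concatenate arcs) and for
its reversal (to run an arc backwards). *)
Lemma RInt_speed_comp_affine (t : R) (X Y : R -> R) (a k u v : R) :
  smooth X -> smooth Y -> Rabs a = 1 ->
  RInt (speed t (fun s => X (a * s + k)) (fun s => Y (a * s + k))) u v =
  a * RInt (speed t X Y) (a * u + k) (a * v + k).
Proof.
intros SX SY Ha.
assert (a2 : a * a = 1).
{ replace (a * a) with (Rabs a * Rabs a); [rewrite Ha; ring |].
  exact (eq_sym (Rsqr_abs a)). }
rewrite -(RInt_comp_lin (speed t X Y) a k u v); [| now apply ex_RInt_speed].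
assert (D : forall f s, smooth f ->
  Derive (fun s => f (a * s + k)) s = a * Derive f (a * s + k)).
{ intros f s Sf; apply is_derive_unique.
  apply (is_derive_comp f (fun s => a * s + k)).
  - apply Derive_correct, (Sf 1%nat).
  - auto_derive; [easy | ring]. }
transitivity (RInt (fun s => scal a (scal a (speed t X Y (a * s + k)))) u v).
2: apply: RInt_scal; apply: (ex_RInt_comp_lin (speed t X Y));
  now apply ex_RInt_speed.
apply RInt_ext; intros s _; unfold speed; rewrite !D; auto.
  change scal with Rmult.
  rewrite -Rmult_assoc a2 Rmult_1_l; do 2 f_equal.
  replace ((a * Derive X (a * s + k)) ^ 2) with (a * a * Derive X (a * s + k) ^ 2)
    by ring.
  replace ((a * Derive Y (a * s + k)) ^ 2) with (a * a * Derive Y (a * s + k) ^ 2)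
    by ring.
  rewrite a2; ring.
Qed.

Lemma joined_arc (t : R) (p q r : R * R) (l m : R) :
  joined t p q l -> arc t q r m -> joined t p r (l + m).
Proof.
intros [c [a [b [Hc [P [Q L]]]]]] [X [Y [S [SX [SY [S0 [Q' [E M]]]]]]]].
assert (ab := piecewise_smooth_lt _ _ _ Hc).
(* The coefficient 1 puts the translation in the form of the affine lemmas. *)
pose (U := fun s => X (1 * s + - b)); pose (V := fun s => Y (1 * s + - b)).
pose (d := fun s => 
  match Rle_dec s b with left _ => c s | right _ => (U s, V s) end).
assert (dc : forall s, a <= s <= b -> c s = d s).
{ intros s Hs; unfold d; destruct (Rle_dec s b); [easy | lra]. }
assert (dU : forall s, b <= s <= b + S -> d s = (U s, V s)).
{ intros s Hs; unfold d; destruct (Rle_dec s b); [| easy].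
  replace s with b by lra; rewrite Q -Q'; unfold U, V; do 2 f_equal; ring. }
assert (H1 : piecewise_smooth d a b) by now apply piecewise_smooth_ext with c.
assert (H2 : piecewise_smooth d b (b + S)).
{ apply piecewise_smooth_piece; [lra | exists U, V; repeat split; auto].
  - now apply smooth_comp_affine.
  - now apply smooth_comp_affine. }
exists d, a, (b + S); split; [now apply piecewise_smooth_cat with b |].
split; [rewrite -dc; [exact P | lra] |].
split; [rewrite dU; [| lra]; rewrite -E; unfold U, V; do 2 f_equal; ring |].
rewrite (length_cat t d a b (b + S) H1 H2); apply Rplus_le_compat.
- replace (length _ d a b) with (length (conformal (u_sol t)) c a b); [exact L |].
  apply: (RInt_ext (integrand t c)).
  rewrite -> Rmin_left, Rmax_right by lra; intros s Hs.
  unfold integrand; rewrite (dc s); [| lra].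
  f_equal; unfold velocity; f_equal.
  + apply Derive_ext_loc.
    apply (filter_imp (fun r => a < r /\ r < b));
      [intros z Hz; rewrite dc; [easy | lra] |].
    apply filter_and; [now apply open_gt | now apply open_lt].
  + apply Derive_ext_loc.
    apply (filter_imp (fun r => a < r /\ r < b));
      [intros z Hz; rewrite dc; [easy | lra] |].
    apply filter_and; [now apply open_gt | now apply open_lt].
- rewrite (length_piece t d U V); [| lra | exact dU].
  unfold U, V; rewrite RInt_speed_comp_affine; auto using Rabs_R1.
  replace (1 * b + - b) with 0 by ring.
  replace (1 * (b + S) + - b) with S by ring.
  now rewrite Rmult_1_l.
Qed.

(** Concatenations of arcs, recorded without choosing a parametrisation of
the whole curve. Reversal and isometries then act arc by arc, and parameters
are matched only once, in [joined_arc]. *)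
Inductive chain (t : R) : R * R -> R * R -> R -> Prop :=
| chain_arc p q l : arc t p q l -> chain t p q l
| chain_cat p q r l m : chain t p q l -> chain t q r m -> chain t p r (l + m).

Lemma arc_sym (t : R) (p q : R * R) (l : R) : arc t p q l -> arc t q p l.
Proof.
intros [X [Y [S [SX [SY [S0 [P [Q L]]]]]]]].
exists (fun s => X (-1 * s + S)), (fun s => Y (-1 * s + S)), S.
repeat split; try (now apply smooth_comp_affine); auto.
- rewrite -Q; do 2 f_equal; ring.
- rewrite -P; do 2 f_equal; ring.
- rewrite RInt_speed_comp_affine; auto; [| rewrite Rabs_left; lra].
  replace (-1 * 0 + S) with S by ring; replace (-1 * S + S) with 0 by ring.
  rewrite -opp_RInt_swap; [| now apply ex_RInt_speed].
  change opp with Ropp; lra.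
Qed.

(** The induction carries along the fact that any curve arriving at p can be
prolonged to q, because arcs are glued one at a time on the right. *)
Lemma chain_joined (t : R) (p q : R * R) (l : R) :
  chain t p q l -> joined t p q l.
Proof.
intros H.
enough (G : joined t p q l /\
  forall o k, joined t o p k -> joined t o q (k + l)) by easy.
induction H as [p q l H | p q r l m _ [J1 E1] _ [J2 E2]]; split.
- now apply arc_joined.
- intros o k Hk; now apply joined_arc with p.
- now apply E2.
- intros o k Hk; rewrite -Rplus_assoc; auto.
Qed.

(** * Lower bound for the diameter *)

(** Cosine of the spherical distance from w = e^z + t to the midpoint m of the
long arc of real points between t and infinity. In R^3, m is the unit vector
- (1, 0, t) / sqrt (1 + t^2), and this is its scalar product with the inverse
stereographic projection of w. *)
Definition cos_dist (t x y : R) : R :=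
  - (t + 2 * exp x * cos y / denom t x y) / sqrt (1 + t ^ 2).

Definition cos_dist_x (t x y : R) : R :=
  - (2 * exp x * cos y * denom t x y
     - 2 * exp x * cos y * (2 * t * exp x * cos y + 2 * exp (2 * x)))
  / (sqrt (1 + t ^ 2) * denom t x y ^ 2).

Definition cos_dist_y (t x y : R) : R :=
  (2 * exp x * sin y * denom t x y
   - 2 * exp x * cos y * (2 * t * exp x * sin y))
  / (sqrt (1 + t ^ 2) * denom t x y ^ 2).

Lemma sqrt_1_sqr_pos (t : R) : 0 < sqrt (1 + t ^ 2).
Proof. apply sqrt_lt_R0; generalize (pow2_ge_0 t); lra. Qed.

Lemma sqrt_1_sqr_pow2 (t : R) : sqrt (1 + t ^ 2) ^ 2 = 1 + t ^ 2.
Proof. apply pow2_sqrt; generalize (pow2_ge_0 t); lra. Qed.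

Lemma is_derive_cos_dist (t : R) (X Y : R -> R) (s : R) :
  ex_derive X s -> ex_derive Y s ->
  is_derive (fun s => cos_dist t (X s) (Y s)) s
    (cos_dist_x t (X s) (Y s) * Derive X s
     + cos_dist_y t (X s) (Y s) * Derive Y s).
Proof.
intros DX DY.
assert (D := Rgt_not_eq _ _ (denom_pos t (X s) (Y s))).
assert (W := Rgt_not_eq _ _ (sqrt_1_sqr_pos t)).
unfold cos_dist, cos_dist_x, cos_dist_y, denom in *.
auto_derive; [now repeat split |].
change (t * (t * 1)) with (t ^ 2).
change (Derive (fun x => X x) s) with (Derive X s).
change (Derive (fun x => Y x) s) with (Derive Y s).
now field.
Qed.

(** The spherical distance r to m satisfies |grad r| = 1 for the pulled back
metric; this is that equation for cos r, where it has no singularity. *)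
Lemma cos_dist_gradient (t x y : R) :
  cos_dist_x t x y ^ 2 + cos_dist_y t x y ^ 2 =
  density t x y ^ 2 * (1 - cos_dist t x y ^ 2).
Proof.
assert (D := Rgt_not_eq _ _ (denom_pos t x y)).
assert (W := Rgt_not_eq _ _ (sqrt_1_sqr_pos t)).
assert (W2 := sqrt_1_sqr_pow2 t).
assert (SC := sin2_cos2 y); unfold Rsqr in SC.
unfold cos_dist_x, cos_dist_y, density, cos_dist.
set (w := sqrt (1 + t ^ 2)) in *; set (d := denom t x y) in *.
assert (Ed : d = 1 + t ^ 2 + 2 * t * exp x * cos y + exp x ^ 2)
  by (unfold d, denom; now rewrite exp_double).
rewrite exp_double.
set (E := exp x) in *; set (C := cos y) in *; set (S := sin y) in *.
assert (S2 : S ^ 2 = 1 - C ^ 2) by (simpl; lra).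
apply Rminus_diag_uniq.
replace (_ - _) with
  (4 * E ^ 2 * (C ^ 2 * (d - 2 * t * E * C - 2 * E ^ 2) ^ 2
     + S ^ 2 * (d - 2 * t * E * C) ^ 2
     - (w ^ 2 * d ^ 2 - (t * d + 2 * E * C) ^ 2)) / (w ^ 2 * d ^ 4))
  by (field; now split).
rewrite S2 W2 Ed; unfold Rdiv.
match goal with |- ?a * _ = 0 => replace a with 0 by ring end; ring.
Qed.

(** Read off from the gradient identity, whose left-hand side is a sum of
squares. *)
Lemma cos_dist_sqr_le (t x y : R) : cos_dist t x y ^ 2 <= 1.
Proof.
assert (G := cos_dist_gradient t x y).
assert (W := density_pos t x y).
assert (0 < density t x y ^ 2) by now apply pow_lt.
generalize (pow2_ge_0 (cos_dist_x t x y)), (pow2_ge_0 (cos_dist_y t x y)); nra.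
Qed.

Lemma is_derive_acos (x : R) :
  -1 < x < 1 -> is_derive acos x (- / sqrt (1 - x ^ 2)).
Proof.
intros Hx; apply is_derive_Reals.
replace (- / sqrt (1 - x ^ 2)) with (-1 / sqrt (1 - x²))
  by (unfold Rdiv, Rsqr; simpl; rewrite Rmult_1_r; ring).
apply (derive_pt_eq_1 _ _ _ (derivable_pt_acos x Hx)), derive_pt_acos.
Qed.

(** The mean value theorem applied to f or - f minus the integral of g: [df] is
compared with [g] pointwise and never integrated. *)
Lemma increment_le_RInt (f df g : R -> R) (a b : R) :
  a < b -> (forall s, is_derive f s (df s)) ->
  (forall s, Rabs (df s) <= g s) -> (forall s, continuous g s) ->
  Rabs (f b - f a) <= RInt g a b.
Proof.
intros ab Hf fg Cg.
assert (Dg : forall s, is_derive (fun r => RInt g a r) s (g s)).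
{ intros s; apply is_derive_RInt with a; [| apply Cg].
  apply filter_forall; intros r; apply: RInt_correct.
  apply: ex_RInt_continuous; intros z _; apply Cg. }
assert (step : forall e, Rabs e = 1 -> e * (f b - f a) <= RInt g a b).
{ intros e He.
  assert (D : forall s, is_derive (fun r => e * f r - RInt g a r) s
                          (e * df s - g s)).
  { intros s; apply: is_derive_minus; [| apply Dg].
    apply: is_derive_scal; apply Hf. }
  destruct (MVT_gen (fun r => e * f r - RInt g a r) a b
              (fun s => e * df s - g s)) as [c [_ Hc]].
  - intros s _; apply D.
  - intros s _; apply derivable_continuous_pt.
    exists (e * df s - g s); apply is_derive_Reals, D.
  - rewrite RInt_point in Hc; change zero with 0 in Hc.
    assert (e * df c <= g c).
    { apply Rle_trans with (Rabs (e * df c)); [apply Rle_abs |].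
      rewrite Rabs_mult He Rmult_1_l; apply fg. }
    nra. }
apply Rabs_le; split.
- generalize (step (-1)); rewrite Rabs_left; lra.
- generalize (step 1); rewrite Rabs_R1; lra.
Qed.

Lemma scaled_cos_dist_bound (t k x y : R) :
  0 < k < 1 -> -1 < k * cos_dist t x y < 1.
Proof. intros Hk; generalize (cos_dist_sqr_le t x y); nra. Qed.

(** By Cauchy-Schwarz and the gradient identity, acos (k h) is 1-Lipschitz for
every k in (0, 1), as k^2 (1 - h^2) <= 1 - (k h)^2. The factor k keeps the
argument of acos away from its singularities at 1 and -1; the value 1 is
attained at m, where the curves of interest start and end. *)
Lemma acos_cos_dist_slope (t k x y a b : R) : 0 < k < 1 ->
  Rabs (k * (cos_dist_x t x y * a + cos_dist_y t x y * b)
        * - / sqrt (1 - (k * cos_dist t x y) ^ 2))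
  <= density t x y * sqrt (a ^ 2 + b ^ 2).
Proof.
intros Hk.
assert (B := scaled_cos_dist_bound t k x y Hk).
assert (G := cos_dist_gradient t x y).
assert (H1 := cos_dist_sqr_le t x y).
assert (W := density_pos t x y).
set (h := cos_dist t x y) in *; set (w := density t x y) in *.
set (p := cos_dist_x t x y) in *; set (q := cos_dist_y t x y) in *.
assert (P : 0 < 1 - (k * h) ^ 2) by nra.
rewrite Rabs_mult Rabs_Ropp Rabs_inv.
rewrite (Rabs_right (sqrt _)); [| apply Rle_ge, sqrt_pos].
apply Rmult_le_reg_r with (sqrt (1 - (k * h) ^ 2)); [now apply sqrt_lt_R0 |].
rewrite Rmult_assoc Rinv_l; [| now apply Rgt_not_eq, sqrt_lt_R0].
rewrite Rmult_1_r Rmult_assoc -sqrt_mult_alt; [| nra].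
rewrite -(sqrt_Rsqr_abs (k * _)) -{1}(sqrt_Rsqr w); [| lra].
rewrite -sqrt_mult_alt; [| apply Rle_0_sqr].
apply sqrt_le_1_alt; unfold Rsqr.
assert (CS : (p * a + q * b) ^ 2 <= w ^ 2 * (1 - h ^ 2) * (a ^ 2 + b ^ 2)).
{ rewrite -G; generalize (pow2_ge_0 (p * b - q * a)); nra. }
assert (K : k ^ 2 * (1 - h ^ 2) <= 1 - (k * h) ^ 2) by nra.
assert (V : 0 <= w ^ 2 * (a ^ 2 + b ^ 2)).
{ apply Rmult_le_pos; [apply pow2_ge_0 |].
  generalize (pow2_ge_0 a), (pow2_ge_0 b); lra. }
apply Rle_trans with (k ^ 2 * (w ^ 2 * (1 - h ^ 2) * (a ^ 2 + b ^ 2))).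
- replace (_ * _) with (k ^ 2 * (p * a + q * b) ^ 2) by ring.
  apply Rmult_le_compat_l; [apply pow2_ge_0 | exact CS].
- replace (_ * _) with (w ^ 2 * (a ^ 2 + b ^ 2) * (k ^ 2 * (1 - h ^ 2))) by ring.
  replace (w * w * _) with (w ^ 2 * (a ^ 2 + b ^ 2) * (1 - (k * h) ^ 2)) by ring.
  now apply Rmult_le_compat_l.
Qed.

Lemma length_ge_acos_increment (t k : R) (c : R -> R * R) (a b : R) :
  0 < k < 1 -> piecewise_smooth c a b ->
  Rabs (acos (k * cos_dist t (fst (c b)) (snd (c b)))
        - acos (k * cos_dist t (fst (c a)) (snd (c a))))
  <= length (conformal (u_sol t)) c a b.
Proof.
intros Hk; induction 1 as [a b ab [X [Y [SX [SY E]]]] | a m b H1 IH1 H2 IH2].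
- rewrite (length_piece t c X Y a b ab E) (E a) ?(E b); [| lra | lra].
  apply (increment_le_RInt (fun s => acos (k * cos_dist t (X s) (Y s)))
    (fun s => k * (cos_dist_x t (X s) (Y s) * Derive X s
                   + cos_dist_y t (X s) (Y s) * Derive Y s)
              * - / sqrt (1 - (k * cos_dist t (X s) (Y s)) ^ 2)) _ a b ab).
  + intros s.
    apply (is_derive_comp acos (fun s => k * cos_dist t (X s) (Y s))).
    * now apply is_derive_acos, scaled_cos_dist_bound.
    * apply: is_derive_scal.
      apply is_derive_cos_dist; now apply smooth_ex_derive.
  + intros s; now apply acos_cos_dist_slope.
  + intros s; now apply continuous_speed.
- rewrite (length_cat t c a m b H1 H2).
  apply Rle_trans with (2 := Rplus_le_compat _ _ _ _ IH1 IH2).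
  rewrite Rplus_comm; apply Rle_trans with (2 := Rabs_triang _ _).
  right; f_equal; ring.
Qed.

(** The intermediate value theorem, applied inside the piece where the sign of
the ordinate changes. *)
Lemma piecewise_smooth_crosses (c : R -> R * R) (a b : R) :
  piecewise_smooth c a b -> snd (c b) <= 0 <= snd (c a) ->
  exists m, a <= m <= b /\ snd (c m) = 0.
Proof.
induction 1 as [a b ab [X [Y [SX [SY E]]]] | a n b H1 IH1 H2 IH2]; intros Hs.
- destruct (IVT_gen Y a b 0) as [m [Hm Ym]].
  + intros s; apply derivable_continuous_pt; exists (Derive Y s).
    now apply is_derive_Reals, Derive_correct, smooth_ex_derive.
  + revert Hs; rewrite (E a) ?(E b); [simpl | lra | lra]; intros Hs.
    rewrite -> Rmin_right, Rmax_left by lra; lra.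
  + rewrite -> Rmin_left, Rmax_right in Hm by lra.
    exists m; split; [exact Hm | now rewrite E].
- assert (L1 := piecewise_smooth_lt _ _ _ H1).
  assert (L2 := piecewise_smooth_lt _ _ _ H2).
  destruct (Rle_dec 0 (snd (c n))) as [pos | neg].
  + destruct IH2 as [m [Hm Z]]; [lra | exists m; split; [lra | exact Z]].
  + destruct IH1 as [m [Hm Z]]; [lra | exists m; split; [lra | exact Z]].
Qed.

Lemma le_acos (z phi : R) :
  -1 <= z <= 1 -> 0 <= phi <= PI -> z <= cos phi -> phi <= acos z.
Proof.
intros Hz Hphi H; apply Rnot_lt_le; intros lt.
assert (B := acos_bound z).
assert (C : cos phi < cos (acos z)) by (apply cos_decreasing_1; lra).
rewrite cos_acos in C; lra.
Qed.

(** On the line y = 0, that is on the short arc, the distance to m is at least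
the distance pi / 2 + atan t from m to the ends of the arc. *)
Lemma cos_dist_slit (t x : R) : 0 <= t -> cos_dist t x 0 <= - sin (atan t).
Proof.
intros ht; rewrite sin_atan; unfold cos_dist, Rsqr; rewrite cos_0.
replace (t * t) with (t ^ 2) by ring.
assert (0 <= 2 * exp x * 1 / denom t x 0).
{ apply Rlt_le, Rdiv_lt_0_compat; [generalize (exp_pos x); lra | apply denom_pos]. }
assert (W := Rinv_0_lt_compat _ (sqrt_1_sqr_pos t)).
unfold Rdiv in *; nra.
Qed.

(** The lifts of m are the points with e^x = sqrt (1 + t^2) and y an odd
multiple of pi: there w = t - sqrt (1 + t^2). *)
Lemma cos_dist_midpoint (t y : R) : cos y = -1 ->
  cos_dist t (ln (sqrt (1 + t ^ 2))) y = 1.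
Proof.
intros Hy; assert (D := denom_pos t (ln (sqrt (1 + t ^ 2))) y).
assert (W := sqrt_1_sqr_pos t).
assert (W2 := sqrt_1_sqr_pow2 t).
unfold cos_dist, denom in *; rewrite exp_double in D |- *.
rewrite -> exp_ln in D |- * by exact W.
rewrite Hy in D |- *; set (w := sqrt (1 + t ^ 2)) in *.
rewrite -> W2 in *.
apply Rmult_eq_reg_r with w; [| lra].
unfold Rdiv at 1; rewrite Rmult_assoc Rinv_l; [| lra].
field_simplify_eq; [| lra].
replace (t ^ 2) with (w ^ 2 - 1) by lra.
replace (t ^ 3) with (t * (w ^ 2 - 1)) by (rewrite W2; ring).
ring.
Qed.

(** The curve is cut at a point where it meets the line y = 0; each half goes
from m to a point of the short arc. *)
Lemma length_ge_pi_atan (t : R) (c : R -> R * R) (a b : R) : 0 <= t ->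
  piecewise_smooth c a b ->
  c a = (ln (sqrt (1 + t ^ 2)), PI) -> c b = (ln (sqrt (1 + t ^ 2)), - PI) ->
  PI + 2 * atan t <= length (conformal (u_sol t)) c a b.
Proof.
intros ht Hc Ea Eb.
assert (pi := PI_RGT_0).
destruct (piecewise_smooth_crosses c a b Hc) as [m [Hm Zm]].
{ rewrite Ea Eb; simpl; lra. }
destruct (piecewise_smooth_cut c a m b Hc) as [H1 H2].
{ split; apply Rnot_le_lt; intros F.
  - replace m with a in Zm by lra; rewrite Ea in Zm; simpl in Zm; lra.
  - replace m with b in Zm by lra; rewrite Eb in Zm; simpl in Zm; lra. }
rewrite (length_cat t c a m b H1 H2).
assert (th := atan_bound t).
assert (th0 : 0 <= atan t).
{ destruct ht as [ht | <-]; [| rewrite atan_0; lra].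
  apply Rlt_le; rewrite -atan_0; now apply atan_increasing. }
apply le_epsilon; intros eps Heps.
(* With k = cos e the endpoint value acos k is e, and each half of the curve
   loses at most 2 e. *)
set (e := Rmin (eps / 4) (1 / 2)).
assert (He : 0 < e) by (apply Rmin_glb_lt; lra).
assert (He4 : e <= eps / 4) by apply Rmin_l.
assert (He2 : e <= 1 / 2) by apply Rmin_r.
assert (pi3 := PI2_3_2).
assert (K : 0 < cos e < 1).
{ split; [apply cos_gt_0; lra |].
  rewrite -cos_0; apply cos_decreasing_1; lra. }
assert (L1 := length_ge_acos_increment t (cos e) c a m K H1).
assert (L2 := length_ge_acos_increment t (cos e) c m b K H2).
rewrite Ea in L1; rewrite Eb in L2; simpl fst in L1, L2; simpl snd in L1, L2.
rewrite (cos_dist_midpoint t PI cos_PI) in L1.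
rewrite (cos_dist_midpoint t (- PI)) in L2; [| rewrite cos_neg; apply cos_PI].
rewrite Rmult_1_r acos_cos in L1; [| lra].
rewrite Rmult_1_r acos_cos in L2; [| lra].
rewrite Zm in L1, L2.
set (z := cos e * cos_dist t (fst (c m)) 0) in *.
assert (Az : PI / 2 + atan t - e <= acos z).
{ apply le_acos; [| lra |].
  - generalize (scaled_cos_dist_bound t (cos e) (fst (c m)) 0 K); fold z; lra.
  - replace (PI / 2 + atan t - e) with (PI / 2 + (atan t - e)) by ring.
    replace (cos (PI / 2 + (atan t - e))) with (- sin (atan t - e))
      by (rewrite sin_minus cos_plus cos_PI2 sin_PI2 sin_minus; ring).
    rewrite sin_minus.
    assert (0 <= cos (atan t)) by (apply cos_ge_0; lra).
    assert (0 <= sin e) by (apply sin_ge_0; lra).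
    assert (S := cos_dist_slit t (fst (c m)) ht).
    unfold z; nra. }
generalize (Rle_abs (acos z - e)), (Rabs_minus_sym e (acos z)).
lra.
Qed.

(** * The half turn exchanging the two ends *)

(** In terms of w it is w |-> (t w + 1) / (w - t), because
e^z = w - t becomes (1 + t^2) / (w - t); this is a rotation of the sphere
swapping t and infinity. *)
Definition half_turn (t : R) (p : R * R) : R * R :=
  (ln (1 + t ^ 2) - fst p, - snd p).

Lemma exp_half_turn (t x : R) :
  exp (ln (1 + t ^ 2) - x) = (1 + t ^ 2) / exp x.
Proof.
unfold Rminus; rewrite exp_plus exp_ln; [now rewrite exp_Ropp |].
generalize (pow2_ge_0 t); lra.
Qed.

Lemma density_half_turn (t x y : R) :
  density t (ln (1 + t ^ 2) - x) (- y) = density t x y.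
Proof.
assert (E := exp_pos x).
assert (D := denom_pos t x y).
assert (D' := denom_pos t (ln (1 + t ^ 2) - x) (- y)).
unfold density, denom in *; rewrite -> !exp_double, exp_half_turn, cos_neg in *.
assert (T := pow2_ge_0 t).
field; repeat split; try lra.
apply Rgt_not_eq; revert D'.
set (a := exp x) in *; set (C := cos y) in *; intros D'.
apply (Rmult_lt_compat_r (a ^ 2)) in D'; [| now apply pow_lt].
rewrite Rmult_0_l in D'.
replace (_ * a ^ 2) with
  ((1 + t ^ 2) * a ^ 2 + 2 * t * ((1 + t ^ 2) * a) * C + (1 + t ^ 2) ^ 2) in D'
  by (field; lra).
nra.
Qed.

Lemma chain_half_turn (t : R) (p q : R * R) (l : R) :
  chain t p q l -> chain t (half_turn t p) (half_turn t q) l.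
Proof.
induction 1 as [p q l H | p q r l m _ IH1 _ IH2].
2: now apply chain_cat with (half_turn t q).
apply chain_arc; destruct H as [X [Y [S [SX [SY [S0 [P [Q L]]]]]]]].
exists (fun s => ln (1 + t ^ 2) + - X s), (fun s => - Y s), S.
split; [now apply smooth_plus; [apply smooth_const | apply smooth_opp] |].
split; [now apply smooth_opp | split; [exact S0 |]].
split; [now rewrite -P | split; [now rewrite -Q |]].
apply Rle_trans with (2 := L); right.
apply RInt_ext; intros s _; unfold speed.
change (ln (1 + t ^ 2) + - X s) with (ln (1 + t ^ 2) - X s).
rewrite density_half_turn; do 2 f_equal.
rewrite Derive_opp Derive_plus.
- rewrite Derive_const Derive_opp; ring.
- apply ex_derive_const.
- now apply: ex_derive_opp; apply smooth_ex_derive.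
Qed.

Lemma half_turn_involutive (t : R) (p : R * R) :
  half_turn t (half_turn t p) = p.
Proof. destruct p as [x y]; unfold half_turn; simpl; f_equal; ring. Qed.

Lemma vertical_arc (t x y z K l : R) :
  (forall y, density t x y <= K) -> K * Rabs (z - y) <= l ->
  arc t (x, y) (x, z) l.
Proof.
intros HK Hl; exists (fun _ => x), (fun s => (z - y) * s + y), 1.
assert (SY : smooth (fun s => (z - y) * s + y))
  by exact (smooth_comp_affine (fun s => s) (z - y) y smooth_id).
split; [apply smooth_const | split; [exact SY | split; [lra |]]].
split; [f_equal; ring | split; [f_equal; ring |]].
apply Rle_trans with (2 := Hl).
replace (K * _) with (RInt (fun _ => K * Rabs (z - y)) 0 1)
  by (rewrite RInt_const; unfold scal; simpl; unfold mult; simpl; ring).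
apply RInt_le; [lra | apply ex_RInt_speed; auto using smooth_const | |].
- apply ex_RInt_const.
- intros s _; unfold speed; rewrite Derive_const.
  replace (Derive _ s) with (z - y)
    by (symmetry; apply is_derive_unique; auto_derive; [easy | ring]).
  replace (0 ^ 2 + (z - y) ^ 2) with ((z - y)²) by (unfold Rsqr; ring).
  rewrite sqrt_Rsqr_abs.
  apply Rmult_le_compat_r; [apply Rabs_pos | apply HK].
Qed.

Lemma density_le (t x y : R) : density t x y <= 2 * exp x.
Proof.
assert (D := denom_pos t x y); assert (E := exp_pos x).
apply Rle_div_l; [exact D |].
assert (1 <= denom t x y).
{ rewrite denom_sum_squares.
  generalize (pow2_ge_0 (t + exp x * cos y)), (pow2_ge_0 (exp x * sin y)); lra. }
nra.
Qed.

(** A vertical line is the lift of the circle of centre t and radius e^x, whose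
circumference on the sphere is O(e^{-x}). *)
Lemma density_tail (t x y : R) :
  0 <= t -> 2 * t <= exp x -> density t x y <= 8 / exp x.
Proof.
intros ht hx; assert (D := denom_pos t x y); assert (E := exp_pos x).
apply Rle_div_l; [exact D |].
apply Rmult_le_reg_r with (exp x); [exact E |].
replace (8 / exp x * denom t x y * exp x) with (8 * denom t x y)
  by (field; lra).
unfold denom; rewrite exp_double.
assert (C := COS_bound y).
assert (0 <= t * exp x * (1 + cos y)).
{ apply Rmult_le_pos; [apply Rmult_le_pos |]; lra. }
nra.
Qed.

(** |w|, where w = e^z + t; the spherical distance from w to infinity is
pi - 2 atan |w|. *)
Definition radius (t x y : R) : R :=
  sqrt ((t + exp x * cos y) ^ 2 + (exp x * sin y) ^ 2).

Lemma radius_nonneg (t x y : R) : 0 <= radius t x y.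
Proof. apply sqrt_pos. Qed.

Lemma radius_sqr (t x y : R) :
  radius t x y ^ 2 = (t + exp x * cos y) ^ 2 + (exp x * sin y) ^ 2.
Proof.
apply pow2_sqrt.
generalize (pow2_ge_0 (t + exp x * cos y)), (pow2_ge_0 (exp x * sin y)); lra.
Qed.

Lemma pow2_le_inv (a b : R) : 0 <= b -> a ^ 2 <= b ^ 2 -> a <= b.
Proof. intros; nra. Qed.

(** With w' the image of w by the half turn, |w'| |w - t| = |1 + t w|. It
remains to use |w - t| <= |w| + t and |1 + t w| >= 1 - t |w|. *)
Lemma radius_half_turn (t x y : R) : 0 <= t ->
  1 - t * radius t x y
  <= radius t (ln (1 + t ^ 2) - x) (- y) * (radius t x y + t).
Proof.
intros ht.
assert (r0 := radius_nonneg t x y).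
assert (r2 := radius_sqr t x y).
assert (q0 := radius_nonneg t (ln (1 + t ^ 2) - x) (- y)).
assert (q2 := radius_sqr t (ln (1 + t ^ 2) - x) (- y)).
set (r := radius t x y) in *; set (q := radius t (ln (1 + t ^ 2) - x) (- y)) in *.
destruct (Rle_lt_dec (1 - t * r) 0) as [neg | pos].
{ apply Rle_trans with (1 := neg), Rmult_le_pos; lra. }
assert (E := exp_pos x).
assert (SC := sin2_cos2 y); unfold Rsqr in SC.
rewrite exp_half_turn cos_neg sin_neg in q2.
set (e := exp x) in *; set (C := cos y) in *; set (S := sin y) in *.
assert (S2 : S ^ 2 = 1 - C ^ 2) by (simpl; lra).
assert (qe : (q * e) ^ 2 = 1 + 2 * t * (t + e * C) + t ^ 2 * r ^ 2).
{ rewrite Rpow_mult_distr q2 r2.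
  replace (((1 + t ^ 2) / e * - S) ^ 2) with (((1 + t ^ 2) / e) ^ 2 * S ^ 2)
    by ring.
  replace ((e * S) ^ 2) with (e ^ 2 * S ^ 2) by ring.
  rewrite S2; field; lra. }
assert (e2 : e ^ 2 = r ^ 2 - 2 * t * (t + e * C) + t ^ 2).
{ rewrite r2; replace ((e * S) ^ 2) with (e ^ 2 * S ^ 2) by ring.
  rewrite S2; ring. }
assert (B : - r <= t + e * C <= r).
{ generalize (pow2_ge_0 (e * S)); intros; split; [|].
  - enough (- (t + e * C) <= r) by lra.
    apply pow2_le_inv; [exact r0 | nra].
  - apply pow2_le_inv; [exact r0 | nra]. }
apply Rle_trans with (q * e).
- apply pow2_le_inv; [apply Rmult_le_pos; lra |].
  rewrite qe; nra.
- apply Rmult_le_compat_l; [exact q0 |].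
  apply pow2_le_inv; [lra | nra].
Qed.

(** This is the bound 2 pi on the perimeter of the spherical triangle with
vertices w, t and infinity. It says that the arctangents of t, |w| and |w'| add up
to at least pi / 2: otherwise the cosine of their sum would be positive, that
is 1 - t |w| > |w'| (|w| + t). *)
Lemma cost_half_turn (t x y : R) : 0 <= t ->
  (PI - 2 * atan (radius t x y))
  + (PI - 2 * atan (radius t (ln (1 + t ^ 2) - x) (- y)))
  <= PI + 2 * atan t.
Proof.
intros ht.
assert (H := radius_half_turn t x y ht).
assert (r0 := radius_nonneg t x y).
assert (q0 := radius_nonneg t (ln (1 + t ^ 2) - x) (- y)).
set (r := radius t x y) in *; set (q := radius t (ln _ - x) _) in *.
apply Rnot_lt_le; intros lt.
assert (tn : forall z, 0 <= z -> 0 <= atan z < PI / 2 /\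
  0 < cos (atan z) /\ sin (atan z) = z * cos (atan z)).
{ intros z Hz; assert (B := atan_bound z).
  assert (P : 0 < cos (atan z)) by (apply cos_gt_0; lra).
  split; [split; [| lra] |].
  - destruct Hz as [Hz | <-]; [| rewrite atan_0; lra].
    apply Rlt_le; rewrite -atan_0; now apply atan_increasing.
  - split; [exact P |]; rewrite -{2}(tan_atan z); unfold tan; field; lra. }
destruct (tn t ht) as [Bt [Ct St]], (tn r r0) as [Br [Cr Sr]],
  (tn q q0) as [Bq [Cq Sq]].
assert (C : 0 < cos (atan t + atan r + atan q)) by (apply cos_gt_0; lra).
rewrite !cos_plus !sin_plus St Sr Sq in C.
replace (_ - _) with (cos (atan t) * cos (atan r) * cos (atan q)
  * (1 - t * r - q * (r + t))) in C by ring.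
assert (0 < cos (atan t) * cos (atan r) * cos (atan q))
  by (repeat apply Rmult_lt_0_compat; assumption).
nra.
Qed.

(** * Rays to infinity *)

Section Ray.

Variables (t x y : R).
Hypothesis off_axis : sin y <> 0.

Let a := t + exp x * cos y.
Let b := exp x * sin y.

(** The ray is w(s) = e^s (a + i b), with a + i b the image of the starting
point. It avoids t because b <> 0, so w(s) - t = e^{z(s)} can be solved: the
real part of z is half the logarithm of |w - t|^2, and the imaginary part is
recovered from the cotangent of arg (w - t), which is defined throughout. *)
Definition ray_sqr (s : R) : R := (exp s * a - t) ^ 2 + (exp s * b) ^ 2.
Definition ray_cot (s : R) : R := (a - t * exp (- s)) / b.
Definition ray_x (s : R) : R := / 2 * ln (ray_sqr s).
(** Normalised by the value at 0 rather than by a branch of the argument, so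
that the lift starts at the prescribed ordinate y. *)
Definition ray_y (s : R) : R := y + atan (ray_cot 0) - atan (ray_cot s).

Lemma ray_b_neq_0 : b <> 0.
Proof.
apply Rmult_integral_contrapositive_currified; [| exact off_axis].
apply Rgt_not_eq, exp_pos.
Qed.

Lemma ray_sqr_pos (s : R) : 0 < ray_sqr s.
Proof.
assert (B := ray_b_neq_0).
assert (0 < (exp s * b) ^ 2).
{ apply pow2_gt_0, Rmult_integral_contrapositive_currified; [| exact B].
  apply Rgt_not_eq, exp_pos. }
unfold ray_sqr; generalize (pow2_ge_0 (exp s * a - t)); lra.
Qed.

Lemma ray_cot_sqr (s : R) :
  1 + ray_cot s ^ 2 = ray_sqr s / (exp s * b) ^ 2.
Proof.
assert (B := ray_b_neq_0).
unfold ray_cot, ray_sqr; rewrite exp_Ropp.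
field; split; [exact B | apply Rgt_not_eq, exp_pos].
Qed.

Lemma ray_start : ray_x 0 = x /\ ray_y 0 = y.
Proof.
split; [| unfold ray_y; ring].
unfold ray_x, ray_sqr, a, b; rewrite exp_0.
assert (SC := sin2_cos2 y); unfold Rsqr in SC.
replace (_ + _) with (exp x ^ 2 * (sin y * sin y + cos y * cos y)) by ring.
rewrite SC Rmult_1_r -exp_double ln_exp; field.
Qed.

Lemma exp_ray_x (s : R) : exp (ray_x s) = sqrt (ray_sqr s).
Proof.
assert (P := ray_sqr_pos s).
apply Rsqr_inj; [apply Rlt_le, exp_pos | apply sqrt_pos |].
rewrite Rsqr_sqrt; [| lra].
unfold Rsqr; rewrite -exp_plus; unfold ray_x.
replace (_ + _) with (ln (ray_sqr s)) by field.
now apply exp_ln.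
Qed.

(** The real part of e^z = w - t. Together with the modulus, given by
[exp_ray_x], it determines 1 + |e^z + t|^2 along the curve. *)
Lemma ray_lift (s : R) : exp (ray_x s) * cos (ray_y s) = exp s * a - t.
Proof.
assert (B := ray_b_neq_0).
assert (E := exp_pos s).
assert (Ex := exp_pos x).
assert (SC := sin2_cos2 y); unfold Rsqr in SC.
assert (p0 : ray_cot 0 = cos y / sin y).
{ unfold ray_cot, a, b; rewrite Ropp_0 exp_0; field; split; [exact off_axis | lra]. }
(* These square roots are the denominators in the sines and cosines of the two
   arctangents. *)
assert (n0 : sqrt (1 + (ray_cot 0)²) = / Rabs (sin y)).
{ rewrite p0 -sqrt_Rsqr_abs -sqrt_inv; f_equal; unfold Rsqr.
  replace (1 + _) with ((sin y * sin y + cos y * cos y) / (sin y * sin y))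
    by now field.
  rewrite SC; now field. }
assert (ns : sqrt (1 + (ray_cot s)²) = exp (ray_x s) / (exp s * Rabs b)).
{ rewrite exp_ray_x.
  replace (1 + (ray_cot s)²) with (ray_sqr s / (exp s * b) ^ 2)
    by (rewrite -ray_cot_sqr; unfold Rsqr; ring).
  rewrite sqrt_div_alt.
  - f_equal; replace ((exp s * b) ^ 2) with ((exp s * b)²) by (unfold Rsqr; ring).
    rewrite sqrt_Rsqr_abs Rabs_mult; f_equal; apply Rabs_right; lra.
  - apply pow2_gt_0, Rmult_integral_contrapositive_currified; [lra | exact B]. }
assert (X := exp_pos (ray_x s)).
assert (Sy : Rabs (sin y) <> 0) by now apply Rabs_no_R0.
unfold ray_y; rewrite cos_minus cos_plus sin_plus !cos_atan !sin_atan n0 ns p0.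
replace (Rabs b) with (exp x * Rabs (sin y))
  by (unfold b; rewrite Rabs_mult; f_equal; symmetry; apply Rabs_right; lra).
assert (A2 : Rabs (sin y) ^ 2 = sin y ^ 2) by apply pow2_abs.
transitivity (exp s * exp x * (Rabs (sin y) ^ 2) * (cos y ^ 2 + sin y ^ 2)
  / sin y * ray_cot s).
{ field; repeat split; auto; lra. }
rewrite A2; replace (cos y ^ 2 + sin y ^ 2) with 1 by (simpl; lra).
unfold ray_cot; rewrite exp_Ropp; unfold b; field; repeat split; auto; lra.
Qed.

Lemma ray_denom (s : R) :
  denom t (ray_x s) (ray_y s) = 1 + (exp s * radius t x y) ^ 2.
Proof.
assert (P := ray_sqr_pos s).
unfold denom; rewrite exp_double Rmult_assoc ray_lift exp_ray_x pow2_sqrt; [| lra].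
rewrite Rpow_mult_distr radius_sqr; unfold ray_sqr, a, b; ring.
Qed.

Lemma smooth_ray : smooth ray_x /\ smooth ray_y.
Proof.
assert (H : forall c d, smooth (fun s => exp s * c + d)).
{ intros c d; apply smooth_plus; [| apply smooth_const].
  apply smooth_mult; [apply smooth_exp | apply smooth_const]. }
split.
- apply smooth_mult; [apply smooth_const |].
  apply smooth_ln; [| exact ray_sqr_pos].
  intros n s; apply (ex_derive_n_ext (fun s =>
    (exp s * a + - t) * (exp s * a + - t) + (exp s * b + 0) * (exp s * b + 0))).
  { intros; unfold ray_sqr; ring. }
  apply smooth_plus; apply smooth_mult; apply H.
- apply smooth_plus; [apply smooth_const |].
  apply smooth_opp, smooth_atan, smooth_mult; [| apply smooth_const].
  apply smooth_plus; [apply smooth_const |].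
  apply smooth_opp, smooth_mult; [apply smooth_const |].
  intros n s; apply (ex_derive_n_ext (fun s => exp (-1 * s + 0))).
  { intros; f_equal; ring. }
  now apply smooth_comp_affine, smooth_exp.
Qed.

(** The speed of the ray w(s) in the round metric. The derivative of
z is w' / (w - t), of modulus |w| / |w - t|. *)
Lemma ray_speed (s : R) :
  speed t ray_x ray_y s =
  2 * (exp s * radius t x y) / (1 + (exp s * radius t x y) ^ 2).
Proof.
assert (P := ray_sqr_pos s).
assert (B := ray_b_neq_0).
assert (E := exp_pos s).
assert (Dx : Derive ray_x s =
  ((exp s * a - t) * (exp s * a) + (exp s * b) ^ 2) / ray_sqr s).
{ apply is_derive_unique; unfold ray_x, ray_sqr in *.
  auto_derive; [exact P | field; lra]. }
assert (Dy : Derive ray_y s = - (t * (exp s * b)) / ray_sqr s).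
{ assert (Q : is_derive ray_cot s (t * exp (- s) / b)).
  { unfold ray_cot; auto_derive; [exact I | field; exact B]. }
  apply is_derive_unique.
  replace (_ / _) with (0 - t * exp (- s) / b * / (1 + ray_cot s ^ 2)).
  - apply: is_derive_minus; [apply: is_derive_const |].
    apply (is_derive_comp atan ray_cot); [| exact Q].
    apply is_derive_Reals, derivable_pt_lim_atan.
  - rewrite ray_cot_sqr exp_Ropp; field; repeat split; auto; lra. }
unfold speed, density; rewrite ray_denom Dx Dy exp_ray_x.
assert (D : 0 < 1 + (exp s * radius t x y) ^ 2)
  by (generalize (pow2_ge_0 (exp s * radius t x y)); lra).
match goal with |- context [sqrt (?u ^ 2 + ?v ^ 2)] =>
  replace (u ^ 2 + v ^ 2) with ((exp s * radius t x y) ^ 2 / ray_sqr s) end.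
- rewrite sqrt_div_alt; [| exact P].
  rewrite sqrt_pow2.
  + field; split; [lra | now apply Rgt_not_eq, sqrt_lt_R0].
  + apply Rmult_le_pos; [lra | apply radius_nonneg].
- rewrite Rpow_mult_distr radius_sqr; fold a b.
  unfold ray_sqr in *; field; lra.
Qed.

(** The integrand is the derivative of 2 atan (e^s |w|). *)
Lemma ray_length (S : R) : 0 <= S ->
  RInt (speed t ray_x ray_y) 0 S <= PI - 2 * atan (radius t x y).
Proof.
intros HS.
rewrite (RInt_ext _ _ _ _ (fun s _ => ray_speed s)).
assert (I : is_RInt (fun s => 2 * (exp s * radius t x y)
                              / (1 + (exp s * radius t x y) ^ 2)) 0 S
  (minus (2 * atan (exp S * radius t x y)) (2 * atan (exp 0 * radius t x y)))).
{ assert (D : forall s, 0 < 1 + (exp s * radius t x y) ^ 2)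
    by (intros s; generalize (pow2_ge_0 (exp s * radius t x y)); lra).
  apply (is_RInt_derive (fun s => 2 * atan (exp s * radius t x y))).
  - intros s _; specialize (D s).
    auto_derive; [exact I |]; unfold Rsqr; field; lra.
  - intros s _; specialize (D s).
    apply: ex_derive_continuous; auto_derive; lra. }
rewrite (is_RInt_unique _ _ _ _ I) exp_0 Rmult_1_l.
change (2 * atan (exp S * radius t x y) - 2 * atan (radius t x y)
        <= PI - 2 * atan (radius t x y)).
generalize (atan_bound (exp S * radius t x y)); lra.
Qed.

Lemma ray_reaches (z : R) : x < z -> exists S, 0 < S /\ ray_x S = z.
Proof.
intros xz.
assert (B := Rabs_pos_lt _ ray_b_neq_0).
(* At parameter U the imaginary part e^U |b| of w is at least e^z in modulus. *)
set (U := Rabs (z - ln (Rabs b))).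
assert (cont : continuity ray_x).
{ intros s; apply derivable_continuous_pt; exists (Derive ray_x s).
  apply is_derive_Reals, Derive_correct, smooth_ex_derive, smooth_ray. }
assert (far : z <= ray_x U).
{ apply Rnot_lt_le; intros lt; apply exp_increasing in lt; revert lt.
  apply Rle_not_lt; rewrite exp_ray_x.
  apply Rle_trans with (exp U * Rabs b).
  - rewrite -{1}(exp_ln _ B) -exp_plus.
    assert (H := Rle_abs (z - ln (Rabs b))); fold U in H.
    destruct (Req_dec z (U + ln (Rabs b))) as [eq | ne]; [right; now f_equal |].
    apply Rlt_le, exp_increasing; lra.
  - rewrite -(Rabs_right (exp U)); [| apply Rle_ge, Rlt_le, exp_pos].
    rewrite -Rabs_mult -sqrt_Rsqr_abs; apply sqrt_le_1_alt.
    unfold ray_sqr, Rsqr; generalize (pow2_ge_0 (exp U * a - t)); lra. }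
destruct ray_start as [x0 _].
assert (U0 := Rabs_pos (z - ln (Rabs b))); fold U in U0.
destruct (IVT_gen ray_x 0 U z cont) as [S [HS E]].
{ rewrite -> x0, Rmin_left, Rmax_right by lra; lra. }
rewrite -> Rmin_left in HS by exact U0.
exists S; split; [| exact E].
destruct HS as [[S0 | <-] _]; [exact S0 | lra].
Qed.

(** The ordinate changes by less than pi, uniformly in [z]: the argument of
w - t stays on one side of the real axis. Hence two such curves can be closed up
far away by a short vertical segment. *)
Lemma escape_to_infinity (z : R) : x < z ->
  exists w, Rabs (w - y) <= PI /\
    arc t (x, y) (z, w) (PI - 2 * atan (radius t x y)).
Proof.
intros xz; destruct (ray_reaches z xz) as [S [S0 E]].
destruct ray_start as [x0 y0].
destruct smooth_ray as [SX SY].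
exists (ray_y S); split.
- unfold ray_y; apply Rabs_le.
  generalize (atan_bound (ray_cot 0)), (atan_bound (ray_cot S)); lra.
- exists ray_x, ray_y, S; repeat split; auto.
  + now rewrite x0 y0.
  + now rewrite E.
  + apply ray_length; lra.
Qed.

End Ray.

(** * Upper bound for the diameter *)

Lemma chain_through_infinity (t x y x' y' eps : R) :
  0 <= t -> sin y <> 0 -> sin y' <> 0 -> 0 < eps ->
  exists l, chain t (x, y) (x', y') l /\
    l <= (PI - 2 * atan (radius t x y)) + (PI - 2 * atan (radius t x' y')) + eps.
Proof.
intros ht Hy Hy' Heps.
set (M := 8 * (2 * PI + Rabs (y - y'))).
assert (pi := PI_RGT_0).
assert (M0 : 0 < M) by (unfold M; generalize (Rabs_pos (y - y')); lra).
assert (Me : 0 < M / eps) by now apply Rdiv_lt_0_compat.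
(* Since e^z >= 1 + z, at abscissa z the tail estimate applies and a vertical
   segment of height at most M / 8 has length at most eps. *)
set (z := Rabs x + Rabs x' + 2 * t + M / eps).
assert (B := exp_ineq1_le z).
assert (Hx := Rle_abs x); assert (Hx' := Rle_abs x').
assert (Ax := Rabs_pos x); assert (Ax' := Rabs_pos x').
destruct (escape_to_infinity t x y Hy z) as [w [W A]]; [unfold z; lra |].
destruct (escape_to_infinity t x' y' Hy' z) as [w' [W' A']]; [unfold z; lra |].
assert (E := exp_pos z).
exists ((PI - 2 * atan (radius t x y))
        + (eps + (PI - 2 * atan (radius t x' y')))); split; [| lra].
apply chain_cat with (z, w); [now apply chain_arc |].
apply chain_cat with (z, w'); [| now apply chain_arc, arc_sym].
apply chain_arc, vertical_arc with (8 / exp z).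
- intros v; apply density_tail; [exact ht | unfold z in *; lra].
- assert (D : Rabs (w' - w) <= 2 * PI + Rabs (y - y')).
  { replace (w' - w) with ((w' - y') + ((y' - y) + (y - w))) by ring.
    apply Rle_trans with (1 := Rabs_triang _ _).
    generalize (Rabs_triang (y' - y) (y - w)).
    rewrite (Rabs_minus_sym y' y) (Rabs_minus_sym y w); lra. }
  apply Rle_trans with (M / exp z).
  + unfold M, Rdiv.
    apply Rle_trans with (8 * / exp z * (2 * PI + Rabs (y - y'))); [| right; ring].
    apply Rmult_le_compat_l; [| exact D].
    generalize (Rinv_0_lt_compat _ E); lra.
  + apply Rle_div_l; [exact E |].
    apply Rle_trans with (eps * (M / eps)); [right; field; lra |].
    apply Rmult_le_compat_l; [lra | unfold z in *; lra].
Qed.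

(** The costs of going through infinity and through t add up, for the two
points together, to at most 2 (pi + 2 atan t); the cheaper route is taken. *)
Lemma chain_off_axis (t x y x' y' eps : R) :
  0 <= t -> sin y <> 0 -> sin y' <> 0 -> 0 < eps ->
  exists l, chain t (x, y) (x', y') l /\ l <= PI + 2 * atan t + eps.
Proof.
intros ht Hy Hy' Heps.
assert (C := cost_half_turn t x y ht).
assert (C' := cost_half_turn t x' y' ht).
destruct (chain_through_infinity t x y x' y' eps) as [l [H L]]; auto.
destruct (chain_through_infinity t (ln (1 + t ^ 2) - x) (- y)
  (ln (1 + t ^ 2) - x') (- y') eps) as [l' [H' L']]; auto;
  try (rewrite sin_neg; lra).
apply chain_half_turn in H'.
change (ln (1 + t ^ 2) - x, - y) with (half_turn t (x, y)) in H'.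
change (ln (1 + t ^ 2) - x', - y') with (half_turn t (x', y')) in H'.
rewrite !half_turn_involutive in H'.
destruct (Rle_dec l l'); [exists l | exists l']; split; auto; lra.
Qed.

(** When w is real the ray from 0 through w may run into t; a small vertical
displacement avoids this. *)
Lemma arc_to_off_axis (t x y eps : R) : 0 < eps ->
  exists z, sin z <> 0 /\ arc t (x, y) (x, z) eps.
Proof.
intros Heps.
assert (E := exp_pos x).
destruct (Req_dec (sin y) 0) as [S | S].
- set (d := Rmin 1 (eps / (2 * exp x))).
  assert (D : 0 < d) by (apply Rmin_glb_lt; [lra | apply Rdiv_lt_0_compat; lra]).
  assert (D1 : d <= 1) by apply Rmin_l.
  exists (y + d); split.
  + rewrite sin_plus S Rmult_0_l Rplus_0_l.
    apply Rmult_integral_contrapositive_currified.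
    * intros C; generalize (sin2_cos2 y); rewrite S C; unfold Rsqr; lra.
    * apply Rgt_not_eq, sin_gt_0; generalize PI2_1; lra.
  + apply vertical_arc with (2 * exp x); [intros; apply density_le |].
    replace (y + d - y) with d by ring; rewrite Rabs_right; [| lra].
    apply Rle_trans with (2 * exp x * (eps / (2 * exp x))).
    * apply Rmult_le_compat_l; [lra | apply Rmin_r].
    * right; field; lra.
- exists y; split; [exact S |].
  apply vertical_arc with (2 * exp x); [intros; apply density_le |].
  rewrite Rminus_diag Rabs_R0; lra.
Qed.

Lemma joined_pi_atan (t : R) (p q : R * R) (eps : R) : 0 <= t -> 0 < eps ->
  joined t p q (PI + 2 * atan t + eps).
Proof.
intros ht Heps; destruct p as [x y], q as [x' y'].
destruct (arc_to_off_axis t x y (eps / 3)) as [z [Z A]]; [lra |].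
destruct (arc_to_off_axis t x' y' (eps / 3)) as [z' [Z' A']]; [lra |].
destruct (chain_off_axis t x z x' z' (eps / 3)) as [l [H L]]; auto; [lra |].
destruct (chain_joined t (x, y) (x', y') (eps / 3 + (l + eps / 3)))
  as [c [a [b [Hc [P [Q Len]]]]]].
- apply chain_cat with (x, z); [now apply chain_arc |].
  apply chain_cat with (x', z'); [exact H |].
  now apply chain_arc, arc_sym.
- exists c, a, b; repeat split; auto; lra.
Qed.

Lemma dist_le_pi_atan (t : R) (p q : R * R) : 0 <= t ->
  Rbar_le (Defs.dist (conformal (u_sol t)) p q) (Finite (PI + 2 * atan t)).
Proof.
intros ht.
assert (H : forall eps, 0 < eps ->
  Rbar_le (Defs.dist (conformal (u_sol t)) p q) (Finite (PI + 2 * atan t + eps))).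
{ intros eps Heps.
  destruct (joined_pi_atan t p q eps ht Heps) as [c [a [b [Hc [P [Q L]]]]]].
  apply Rbar_le_trans with (Finite (length (conformal (u_sol t)) c a b));
    [| exact L].
  apply Glb_Rbar_correct; now exists c, a, b. }
destruct (Defs.dist (conformal (u_sol t)) p q) as [d | |]; simpl in *.
- apply le_epsilon, H.
- exact (H 1 Rlt_0_1).
- exact I.
Qed.

Theorem proposition1p2 (t : R) (ht : 0 <= t) :
  solves_liouville (u_sol t) /\
  diam (conformal (u_sol t)) = Finite (PI + 2 * atan t).
Proof.
split; [apply u_sol_solves |].
apply Rbar_is_lub_unique; split.
- intros d [p [q ->]]; now apply dist_le_pi_atan.
- intros d Hd.
  set (x := ln (sqrt (1 + t ^ 2))).
  apply Rbar_le_trans with (Defs.dist (conformal (u_sol t)) (x, PI) (x, - PI)).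
  + apply Glb_Rbar_correct; intros l [c [a [b [Hc [P [Q ->]]]]]].
    now apply length_ge_pi_atan.
  + apply Hd; now exists (x, PI), (x, - PI).
Qed.
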